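(* Let $K$ be a field of characteristic zero, let $G$ be a finite abelian group and $A_e$ a (two-sided) noetherian $K$-algebra. Suppose that $G$ acts on $A_e$ by algebra automorphisms, that $c:G\times G\to K^\times$ is a cocycle, and that $A=A_e*_cG$ is the corresponding crossed product. Then $A$ is an FCR-algebra if and only if $A_e$ is an FCR-algebra.
   Context: Algebras are associative unital $K$-algebras. $K^\times=K\setminus\{0\}$. FCR-algebra: an associative $K$-algebra $B$ such that every finite-dimensional representation of $B$ is completely reducible and the intersection of the annihilators of all finite-dimensional representations of $B$ is zero. Cocycle: a map $c:G\times G\to K^\times$ with $c(g,h)c(gh,k)=c(h,k)c(g,hk)$ for all $g,h,k\in G$. Crossed product: $A_e*_cG$ is the free $A_e$-module with basis $\overline{G}=\{\overline{g}\mid g\in G\}$ (a copy of the set $G$), with multiplication $(a*\overline{g})\cdot(b*\overline{h})=c(g,h)\,a\,(g.b)*\overline{gh}$ for all $g,h\in G$, $a,b\in A_e$, where $g.b$ denotes the $G$-action on $A_e$. *)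

(* Defs.v *)
From HB Require Import structures.
From mathcomp Require Import all_boot all_order all_algebra all_fingroup.

Set Implicit Arguments.
Unset Strict Implicit.
Unset Printing Implicit Defensive.

Import GRing.Theory.
Local Open Scope ring_scope.

(* Ideals are Prop-valued predicates, so that no decidability is built into
   the chain conditions. *)
Section Noetherian.
Variable R : nzRingType.
Implicit Type I : R -> Prop.

Record left_ideal I : Prop := LeftIdeal {
  left_ideal0 : I 0;
  left_idealD : forall x y, I x -> I y -> I (x + y);
  left_idealM : forall r x, I x -> I (r * x) }.

Record right_ideal I : Prop := RightIdeal {
  right_ideal0 : I 0;
  right_idealD : forall x y, I x -> I y -> I (x + y);
  right_idealM : forall r x, I x -> I (x * r) }.

Definition acc_on (P : (R -> Prop) -> Prop) : Prop :=
  forall I_ : nat -> R -> Prop,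
    (forall n, P (I_ n)) ->
    (forall n x, I_ n x -> I_ n.+1 x) ->
    exists N : nat, forall n, (N <= n)%N -> forall x, I_ n x -> I_ N x.

Definition left_noetherian : Prop := acc_on left_ideal.
Definition right_noetherian : Prop := acc_on right_ideal.
Definition noetherian : Prop := left_noetherian /\ right_noetherian.

End Noetherian.

Section FCR.
Variables (K : fieldType) (B : algType K).

(* [rep_map] is a unital algebra morphism to 'End(V) under composition, so V is
   a left B-module. This is spelled out because 'End(V) has no canonical ring
   structure for an arbitrary V (which may be 0). *)
Record fd_rep := FDRep {
  rep_space : vectType K;
  rep_map :> {linear B -> 'End(rep_space)};
  rep_map1 : rep_map 1 = \1%VF;
  rep_mapM : forall a b : B, rep_map (a * b) = (rep_map a \o rep_map b)%VF }.

Definition subrep (rho : fd_rep) (U : {vspace rep_space rho}) : Prop :=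
  forall b : B, (rho b @: U <= U)%VS.

(* Same formulation as [mx_completely_reducible] in mxrepresentation. *)
Definition completely_reducible (rho : fd_rep) : Prop :=
  forall U : {vspace rep_space rho}, subrep U ->
  exists W : {vspace rep_space rho},
    [/\ subrep W, (U + W = fullv)%VS & (U :&: W = 0)%VS].

Definition annihilator (rho : fd_rep) (b : B) : Prop := rho b = 0.

Definition FCR_algebra : Prop :=
  (forall rho : fd_rep, completely_reducible rho) /\
  (forall b : B, (forall rho : fd_rep, annihilator rho b) -> b = 0).

End FCR.

Record cocycle (K : fieldType) (gT : finGroupType) (c : gT -> gT -> K) : Prop :=
  Cocycle {
    cocycle_neq0 : forall g h, c g h != 0;
    cocycleE : forall g h k,
      c g h * c (g * h)%g k = c h k * c g (h * k)%g }.

(* Each [act g] is then invertible, with inverse [act g^-1]: it is an algebra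
   automorphism. *)
Record alg_action (K : fieldType) (gT : finGroupType) (Ae : algType K)
    (act : gT -> {lrmorphism Ae -> Ae}) : Prop := AlgAction {
  alg_act1 : forall a, act 1%g a = a;
  alg_actM : forall g h a, act (g * h)%g a = act g (act h a) }.

Section CrossedProduct.
Variables (K : fieldType) (gT : finGroupType) (Ae : algType K).
Variables (act : gT -> {lrmorphism Ae -> Ae}) (c : gT -> gT -> K).
Hypotheses (actP : alg_action act) (cP : cocycle c).

(* A function f stands for the sum over g of f g * \overline{g}. *)
Definition crossed_product : Type := {ffun gT -> Ae}.
HB.instance Definition _ := GRing.Lmodule.copy crossed_product {ffun gT -> Ae}.

Implicit Types f : crossed_product.

Definition cp_single (a : Ae) (g : gT) : crossed_product :=
  [ffun k => if k == g then a else 0].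

(* Biadditive extension of the product rule for the elements a * \overline{g},
   see [cp_mul_single]. *)
Definition cp_mul f1 f2 : crossed_product :=
  \sum_g \sum_h cp_single (c g h *: (f1 g * act g (f2 h))) (g * h)%g.

(* \overline{1} need not be the unit, since c is not assumed normalised. *)
Definition cp_one : crossed_product := cp_single ((c 1%g 1%g)^-1)%:A 1%g.

Lemma cp_addE f1 f2 g : (f1 + f2) g = f1 g + f2 g.
Proof. exact: ffunE. Qed.

Lemma cp_0E g : (0 : crossed_product) g = 0.
Proof. exact: ffunE. Qed.

Lemma cp_scaleE (x : K) f g : (x *: f) g = x *: f g.
Proof. exact: ffunE. Qed.

Lemma cp_singleE a g h : cp_single a g h = if h == g then a else 0.
Proof. exact: ffunE. Qed.

Lemma cp_singleD g : {morph cp_single^~ g : a b / a + b}.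
Proof.
by move=> a b; apply/ffunP=> k; rewrite cp_addE !cp_singleE; case: eqP; rewrite ?addr0.
Qed.

Lemma cp_single0 g : cp_single 0 g = 0.
Proof. by apply/ffunP=> k; rewrite cp_0E cp_singleE if_same. Qed.

Lemma cp_singleZ x a g : cp_single (x *: a) g = x *: cp_single a g.
Proof.
by apply/ffunP=> k; rewrite cp_scaleE !cp_singleE; case: eqP; rewrite ?scaler0.
Qed.

Lemma cp_expand f : f = \sum_g cp_single (f g) g.
Proof.
have sumE (F : gT -> crossed_product) k : (\sum_g F g) k = \sum_g F g k.
  apply: (big_morph (fun u : crossed_product => u k)); last exact: cp_0E.
  by move=> u v /=; rewrite cp_addE.
apply/ffunP=> k; rewrite sumE (bigD1 k) //= cp_singleE eqxx big1 ?addr0 //.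
by move=> g /negPf ngk; rewrite cp_singleE eq_sym ngk.
Qed.

Lemma cp_mul_single a b g h :
  cp_mul (cp_single a g) (cp_single b h)
  = cp_single (c g h *: (a * act g b)) (g * h)%g.
Proof.
rewrite /cp_mul (bigD1 g) //= [X in _ + X]big1 ?addr0; last first.
  move=> g' /negPf ng; apply: big1 => h' _.
  by rewrite cp_singleE ng mul0r scaler0 cp_single0.
rewrite (bigD1 h) //= [X in _ + X]big1 ?addr0; last first.
  move=> h' /negPf nh.
  by rewrite [cp_single b h h']cp_singleE nh raddf0 mulr0 scaler0 cp_single0.
by rewrite !cp_singleE !eqxx.
Qed.

Lemma cp_mulDl : left_distributive cp_mul +%R.
Proof.
move=> f1 f2 f3; rewrite /cp_mul -big_split; apply: eq_bigr => g _ /=.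
rewrite -big_split; apply: eq_bigr => h _ /=.
by rewrite cp_addE mulrDl scalerDr cp_singleD.
Qed.

Lemma cp_mulDr : right_distributive cp_mul +%R.
Proof.
move=> f1 f2 f3; rewrite /cp_mul -big_split; apply: eq_bigr => g _ /=.
rewrite -big_split; apply: eq_bigr => h _ /=.
by rewrite cp_addE raddfD mulrDr scalerDr cp_singleD.
Qed.

Lemma cp_scaleAl (x : K) f1 f2 : x *: cp_mul f1 f2 = cp_mul (x *: f1) f2.
Proof.
rewrite /cp_mul scaler_sumr; apply: eq_bigr => g _.
rewrite scaler_sumr; apply: eq_bigr => h _.
by rewrite cp_scaleE -scalerAl -cp_singleZ !scalerA mulrC.
Qed.

Lemma cp_scaleAr (x : K) f1 f2 : x *: cp_mul f1 f2 = cp_mul f1 (x *: f2).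
Proof.
rewrite /cp_mul scaler_sumr; apply: eq_bigr => g _.
rewrite scaler_sumr; apply: eq_bigr => h _.
by rewrite cp_scaleE linearZ -scalerAr -cp_singleZ !scalerA mulrC.
Qed.

Lemma cp_mul0l f : cp_mul 0 f = 0.
Proof. by apply: (addIr (cp_mul 0 f)); rewrite -cp_mulDl !add0r. Qed.

Lemma cp_mul0r f : cp_mul f 0 = 0.
Proof. by apply: (addIr (cp_mul f 0)); rewrite -cp_mulDr !add0r. Qed.

Lemma cp_mul_suml (F : gT -> crossed_product) f :
  cp_mul (\sum_g F g) f = \sum_g cp_mul (F g) f.
Proof. exact: (big_morph (cp_mul^~ f) (fun u v => cp_mulDl u v f) (cp_mul0l f)). Qed.

Lemma cp_mul_sumr f (F : gT -> crossed_product) :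
  cp_mul f (\sum_g F g) = \sum_g cp_mul f (F g).
Proof. exact: (big_morph (cp_mul f) (cp_mulDr f) (cp_mul0r f)). Qed.

Lemma cp_mulA : associative cp_mul.
Proof.
have singleA a1 a2 a3 g1 g2 g3 :
    cp_mul (cp_single a1 g1) (cp_mul (cp_single a2 g2) (cp_single a3 g3))
    = cp_mul (cp_mul (cp_single a1 g1) (cp_single a2 g2)) (cp_single a3 g3).
  rewrite !cp_mul_single mulgA; congr cp_single.
  rewrite linearZ rmorphM /= -(alg_actM actP) -scalerAr -scalerAl !scalerA mulrA.
  by rewrite mulrC -(cocycleE cP) mulrC.
move=> f1 f2 f3; rewrite (cp_expand f1) !cp_mul_suml; apply: eq_bigr => g1 _.
rewrite (cp_expand f2) cp_mul_suml !cp_mul_sumr cp_mul_suml.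
apply: eq_bigr => g2 _; rewrite (cp_expand f3) !cp_mul_sumr.
by apply: eq_bigr => g3 _; exact: singleA.
Qed.

Let c1l g : c 1%g g = c 1%g 1%g.
Proof.
apply: (mulIf (cocycle_neq0 cP 1%g g)).
by move: (cocycleE cP 1%g 1%g g); rewrite !mul1g => <-.
Qed.

Let c1r g : c g 1%g = c 1%g 1%g.
Proof.
apply: (mulIf (cocycle_neq0 cP g 1%g)).
by move: (cocycleE cP g 1%g 1%g); rewrite !mulg1 => ->.
Qed.

Lemma cp_mul1l : left_id cp_one cp_mul.
Proof.
move=> f; rewrite {1}(cp_expand f) cp_mul_sumr [RHS]cp_expand.
apply: eq_bigr => g _; rewrite cp_mul_single mul1g (alg_act1 actP) c1l.
by rewrite mulr_algl scalerA divff ?scale1r // (cocycle_neq0 cP).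
Qed.

Lemma cp_mul1r : right_id cp_one cp_mul.
Proof.
move=> f; rewrite {1}(cp_expand f) cp_mul_suml [RHS]cp_expand.
apply: eq_bigr => g _; rewrite cp_mul_single mulg1 c1r linearZ rmorph1.
by rewrite mulr_algr scalerA divff ?scale1r // (cocycle_neq0 cP).
Qed.

Lemma cp_one_neq0 : cp_one != 0.
Proof.
apply/eqP=> /(congr1 (fun f : crossed_product => f 1%g)).
rewrite cp_0E cp_singleE eqxx => /eqP.
by rewrite scaler_eq0 invr_eq0 (negPf (cocycle_neq0 cP _ _)) oner_eq0.
Qed.

End CrossedProduct.

(* The algebra structure needs the action and cocycle laws, so the type that
   carries it is indexed by their proofs. *)
Section CrossedProductAlgebra.
Variables (K : fieldType) (gT : finGroupType) (Ae : algType K).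
Variables (act : gT -> {lrmorphism Ae -> Ae}) (c : gT -> gT -> K).
Variables (actP : alg_action act) (cP : cocycle c).

Definition crossed_algebra of alg_action act & cocycle c : Type :=
  crossed_product gT Ae.

Local Notation A := (crossed_algebra actP cP).

HB.instance Definition _ := GRing.Lmodule.copy A (crossed_product gT Ae).
HB.instance Definition _ := GRing.Zmodule_isNzRing.Build A
  (@cp_mulA K gT Ae act c actP cP) (@cp_mul1l K gT Ae act c actP cP)
  (@cp_mul1r K gT Ae act c cP) (@cp_mulDl K gT Ae act c)
  (@cp_mulDr K gT Ae act c) (@cp_one_neq0 K gT Ae c cP).
HB.instance Definition _ := GRing.Lmodule_isLalgebra.Build K A
  (@cp_scaleAl K gT Ae act c).
HB.instance Definition _ := GRing.Lalgebra_isAlgebra.Build K A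
  (@cp_scaleAr K gT Ae act c).

Lemma crossed_single_mul a b g h :
  (cp_single a g : A) * (cp_single b h : A)
  = cp_single (c g h *: (a * act g b)) (g * h)%g.
Proof. exact: cp_mul_single. Qed.

Lemma crossed_1E : (1 : A) = cp_single ((c 1%g 1%g)^-1)%:A 1%g.
Proof. by []. Qed.

End CrossedProductAlgebra.

(* Main.v *)
(* Write A for the crossed product.  An A-submodule that splits over Ae splits
   over A, by averaging the projection over the units \overline{g}, as in
   Maschke's theorem.  Conversely, an Ae-module V is a direct summand of
   Ind V = A (x)_Ae V over Ae, so that an A-linear projection of Ind V onto
   Ind U, followed by the projection onto the component at 1, splits U in V.
   Induction and restriction also carry the residual condition over: a
   coefficient f g annihilates every V as soon as f annihilates every Ind V. *)
Require Import Defs.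
From HB Require Import structures.
From mathcomp Require Import all_boot all_order all_algebra all_fingroup.

Set Implicit Arguments.
Unset Strict Implicit.
Unset Printing Implicit Defensive.

Import GRing.Theory.
Local Open Scope ring_scope.

(** * Representations applied to vectors *)

Lemma rep1E (K : fieldType) (B : algType K) (rho : fd_rep B)
    (v : rep_space rho) :
  rho 1 v = v.
Proof. by rewrite rep_map1 id_lfunE. Qed.

Lemma repME (K : fieldType) (B : algType K) (rho : fd_rep B) (a b : B)
    (v : rep_space rho) :
  rho (a * b) v = rho a (rho b v).
Proof. by rewrite rep_mapM comp_lfunE. Qed.

Lemma repDE (K : fieldType) (B : algType K) (rho : fd_rep B) (a b : B)
    (v : rep_space rho) :
  rho (a + b) v = rho a v + rho b v.
Proof. by rewrite linearD add_lfunE. Qed.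

Lemma repZE (K : fieldType) (B : algType K) (rho : fd_rep B) (x : K) (b : B)
    (v : rep_space rho) :
  rho (x *: b) v = x *: rho b v.
Proof. by rewrite linearZ /= scale_lfunE. Qed.

Lemma rep_sumE (K : fieldType) (B : algType K) (rho : fd_rep B) (I : finType)
    (F : I -> B) (v : rep_space rho) :
  rho (\sum_i F i) v = \sum_i rho (F i) v.
Proof. by rewrite linear_sum sum_lfunE. Qed.

(** * Complete reducibility through equivariant projections *)

Definition equivariant_projection (K : fieldType) (B : algType K)
    (rho : fd_rep B) (U : {vspace rep_space rho})
    (p : 'End(rep_space rho)) : Prop :=
  [/\ forall b v, p (rho b v) = rho b (p v),
      forall v, p v \in U & forall u, u \in U -> p u = u].

Lemma subrepP (K : fieldType) (B : algType K) (rho : fd_rep B)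
    (U : {vspace rep_space rho}) :
  subrep U <-> forall b u, u \in U -> rho b u \in U.
Proof.
split=> [sU b u Uu | sU b]; first exact: (subvP (sU b)) (memv_img _ Uu).
by apply/subvP=> _ /memv_imgP[u Uu ->]; apply: sU.
Qed.

Lemma completely_reducibleP (K : fieldType) (B : algType K) (rho : fd_rep B) :
  completely_reducible rho <->
  forall U : {vspace rep_space rho}, subrep U ->
    exists p, equivariant_projection U p.
Proof.
split=> rhoP U sU; have [W] := rhoP U sU.
  case=> sW UW_full UW0; exists (daddv_pi U W).
  have WU0 : (W :&: U = 0)%VS by rewrite capvC.
  (* The two projections of [w] add up to [w], and the one onto [W] is already [w]. *)
  have piW w : w \in W -> daddv_pi U W w = 0.
    move=> Ww; have := daddv_pi_add UW0 (subvP (addvSr U W) w Ww).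
    by rewrite (daddv_pi_id WU0 Ww) => /(canRL (addrK w)); rewrite subrr.
  split=> [b v | v | u Uu]; [ | exact: memv_pi | exact: daddv_pi_id].
  have : v \in (U + W)%VS by rewrite UW_full memvf.
  case/memv_addP=> u Uu [w Ww ->].
  rewrite !linearD /= (piW w) // (piW (rho b w)); last first.
    exact: (proj1 (subrepP W) sW).
  by rewrite linear0 !daddv_pi_id //; apply: (proj1 (subrepP U) sU).
(* Here [W] names the projection; its kernel is the complement. *)
case=> pC pU pid; exists (lker W); split.
- by apply/subrepP=> b w; rewrite !memv_ker pC => /eqP->; rewrite linear0.
- apply/eqP; rewrite eqEsubv subvf /=; apply/subvP=> v _.
  rewrite -(subrKC (W v) v) memv_add // memv_ker linearB /=.
  by rewrite (pid (W v)) ?subrr.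
- apply/eqP; rewrite -subv0; apply/subvP=> v; rewrite memv_cap memv_ker.
  by case/andP=> /pid->; rewrite memv0.
Qed.

Section Restriction.
Variables (K : fieldType) (B C : algType K) (phi : {lrmorphism B -> C}).
Variable rho : fd_rep C.

Lemma restrict_map1 : (rho \o phi) 1 = \1%VF.
Proof. by rewrite /= rmorph1 rep_map1. Qed.

Lemma restrict_mapM a b :
  (rho \o phi) (a * b) = (rho (phi a) \o rho (phi b))%VF.
Proof. by rewrite /= rmorphM rep_mapM. Qed.

Definition restrict_rep : fd_rep B := FDRep restrict_map1 restrict_mapM.

End Restriction.

(** * Cocycle identities *)

Lemma cocycle1g (K : fieldType) (gT : finGroupType) (c : gT -> gT -> K) g :
  cocycle c -> c 1%g g = c 1%g 1%g.
Proof.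
move=> cP; apply: (mulIf (cocycle_neq0 cP 1%g g)).
by move: (cocycleE cP 1%g 1%g g); rewrite !mul1g => <-.
Qed.

Lemma cocycleg1 (K : fieldType) (gT : finGroupType) (c : gT -> gT -> K) g :
  cocycle c -> c g 1%g = c 1%g 1%g.
Proof.
move=> cP; apply: (mulIf (cocycle_neq0 cP g 1%g)).
by move: (cocycleE cP g 1%g 1%g); rewrite !mulg1 => ->.
Qed.

(** The cocycle law at [g], [g^-1], [g], where both remaining factors equal [c 1 1]. *)
Lemma cocyclegV (K : fieldType) (gT : finGroupType) (c : gT -> gT -> K) g :
  cocycle c -> c g^-1%g g = c g g^-1%g.
Proof.
move=> cP; apply: (mulIf (cocycle_neq0 cP 1%g 1%g)).
move: (cocycleE cP g g^-1%g g).
by rewrite mulgV mulVg cocycle1g // cocycleg1 // => ->.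
Qed.

(** * The base algebra and the units [\overline{g}] inside the crossed product *)

Section CrossedProduct.
Variables (K : fieldType) (gT : finGroupType) (Ae : algType K).
Variables (act : gT -> {lrmorphism Ae -> Ae}) (c : gT -> gT -> K).
Variables (actP : alg_action act) (cP : cocycle c).

Local Notation A := (crossed_algebra actP cP).
Local Notation c11 := (c 1%g 1%g).

Let c_neq0 := cocycle_neq0 cP.

Definition cp_basis (g : gT) : A := cp_single 1 g.

(** Since [\overline{1}] is [c11] times the unit, the factor [c11^-1] is what makes this a unital
    morphism. *)
Definition cp_embed (a : Ae) : A := cp_single (c11^-1 *: a) 1%g.

Lemma cp_embed_linear : linear cp_embed.
Proof.
move=> x a b; rewrite /cp_embed scalerDr cp_singleD.
by rewrite scalerA mulrC -scalerA cp_singleZ.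
Qed.
HB.instance Definition _ := GRing.isLinear.Build K Ae A *:%R cp_embed
  cp_embed_linear.

Lemma cp_embed_monoid_morphism : monoid_morphism cp_embed.
Proof.
split=> [//|a b]; rewrite /cp_embed crossed_single_mul mulg1 linearZ /=.
rewrite (alg_act1 actP) -scalerAl -scalerAr !scalerA mulfV // mul1r //.
Qed.
HB.instance Definition _ := GRing.isMonoidMorphism.Build Ae A cp_embed
  cp_embed_monoid_morphism.

Lemma cp_basisM g h : cp_basis g * cp_basis h = c g h *: cp_basis (g * h)%g.
Proof.
by rewrite /cp_basis crossed_single_mul rmorph1 mulr1 cp_singleZ.
Qed.

Lemma cp_basis1 : cp_basis 1%g = c11 *: 1.
Proof. by rewrite crossed_1E -cp_singleZ scalerA mulfV // scale1r. Qed.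

Lemma cp_embed_basis a g : cp_embed a * cp_basis g = cp_single a g.
Proof.
rewrite crossed_single_mul mul1g rmorph1 mulr1 cocycle1g // scalerA mulfV //.
by rewrite scale1r.
Qed.

Lemma cp_basis_embed g a :
  cp_basis g * cp_embed a = cp_embed (act g a) * cp_basis g.
Proof.
rewrite cp_embed_basis crossed_single_mul mulg1 mul1r linearZ /= cocycleg1 //.
by rewrite scalerA mulfV // scale1r.
Qed.

(** The inverse of [\overline{g}]: the scalar comes from [\overline{g} * \overline{g^-1} = c g g^-1
    *: \overline{1}] and [\overline{1} = c11 *: 1]. *)
Definition cp_basisV g : A := (c g g^-1%g * c11)^-1 *: cp_basis g^-1%g.

Lemma cp_basisK g : cp_basis g * cp_basisV g = 1.
Proof.
rewrite /cp_basisV -scalerAr cp_basisM mulgV cp_basis1 !scalerA -mulrA mulVf.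
  by rewrite scale1r.
by rewrite mulf_neq0.
Qed.

Lemma cp_basisVK g : cp_basisV g * cp_basis g = 1.
Proof.
rewrite /cp_basisV -scalerAl cp_basisM mulVg cp_basis1 !scalerA -mulrA.
by rewrite cocyclegV // mulVf ?scale1r ?mulf_neq0.
Qed.

Lemma cp_basisV_embed g a :
  cp_basisV g * cp_embed (act g a) = cp_embed a * cp_basisV g.
Proof.
rewrite -[LHS]mulr1 -(cp_basisK g) !mulrA -(mulrA (cp_basisV g)).
by rewrite -cp_basis_embed mulrA cp_basisVK mul1r.
Qed.

(** Obtained by inverting [\overline{h} * \overline{g} = c h g *: \overline{hg}]; it absorbs
    [\overline{h}] when the averaging sum is reindexed. *)
Lemma cp_basisV_basis g h :
  cp_basisV (h * g)%g * cp_basis h = c h g *: cp_basisV g.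
Proof.
rewrite -[LHS]mulr1 -(cp_basisK g) !mulrA -(mulrA (cp_basisV _)) cp_basisM.
by rewrite -(scalerAr (c h g)) cp_basisVK -scalerAl mul1r.
Qed.

Lemma cp_decomp (f : A) : f = \sum_g cp_embed (f g) * cp_basis g.
Proof.
by rewrite [LHS]cp_expand; apply: eq_bigr => g _; rewrite cp_embed_basis.
Qed.

(* Maschke averaging; the cocycle cancels between [\overline{g}] and its
   inverse. *)
Lemma crossed_completely_reducible (rho : fd_rep A) :
  #|gT|%:R != 0 :> K ->
  completely_reducible (restrict_rep cp_embed rho) -> completely_reducible rho.
Proof.
move=> nzG /completely_reducibleP resP; apply/completely_reducibleP=> U sU.
have rhoU := proj1 (subrepP _) sU.
have [|p [pC pU pid]] := resP U; first by move=> a; apply: sU.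
pose q :=
  (#|gT|%:R^-1 *: \sum_g (rho (cp_basis g) \o p \o rho (cp_basisV g)))%VF.
have qE v :
    q v = #|gT|%:R^-1 *: \sum_g rho (cp_basis g) (p (rho (cp_basisV g) v)).
  rewrite scale_lfunE sum_lfunE; congr (_ *: _).
  by apply: eq_bigr => g _; rewrite !comp_lfunE.
have q_embed a v : q (rho (cp_embed a) v) = rho (cp_embed a) (q v).
  rewrite !qE linearZ /=; congr (_ *: _); rewrite linear_sum.
  apply: eq_bigr => g _ /=.
  (* In this form [a] passes through the inverse of [\overline{g}], then through [p], and is twisted
     back by [\overline{g}]. *)
  have {1}-> : a = act g (act g^-1%g a).
    by rewrite -(alg_actM actP) mulgV (alg_act1 actP).
  rewrite -repME cp_basisV_embed repME (pC (act g^-1%g a)) /=.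
  rewrite -(repME (cp_basis g)) cp_basis_embed repME.
  by rewrite -(alg_actM actP) mulgV (alg_act1 actP).
have q_basis h v : q (rho (cp_basis h) v) = rho (cp_basis h) (q v).
  rewrite !qE linearZ /=; congr (_ *: _); rewrite linear_sum.
  (* With [h * g] in place of [g] on the left, both sides carry the same scalar [c h g]. *)
  rewrite (reindex_inj (mulgI h)) /=; apply: eq_bigr => g _.
  rewrite -repME cp_basisV_basis repZE linearZ /= -repME cp_basisM.
  by rewrite [RHS]repZE [LHS]linearZ.
exists q; split=> [f v | v | u Uu].
- rewrite [f]cp_decomp !rep_sumE linear_sum; apply: eq_bigr => g _ /=.
  by rewrite !repME q_embed q_basis.
- rewrite qE memvZ // memv_suml // => g _; exact: rhoU.
(* Each summand is [u], because [p] fixes the translate of [u], which stays in [U]. *)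
- rewrite qE (eq_bigr (fun=> u)) => [|g _].
    by rewrite sumr_const -scaler_nat scalerA mulVf ?scale1r.
  by rewrite pid ?rhoU // -repME cp_basisK rep1E.
Qed.

(** * Induced representations *)

Section Induction.
Variable rho : fd_rep Ae.
Local Notation V := (rep_space rho).
Local Notation IndV := {ffun gT -> V}.

(* The function w stands for the sum over k of \overline{k} (x) w k, and
   a * \overline{k} = \overline{k} * (k^-1 . a). *)
Definition ind_act (f : A) (w : IndV) : IndV :=
  [ffun k => \sum_g c g (g^-1 * k)%g *:
                rho (act k^-1%g (f g)) (w (g^-1 * k)%g)].

Lemma ind_actP f : linear (ind_act f).
Proof.
move=> x u v; apply/ffunP=> k; rewrite !ffunE scaler_sumr -big_split /=.
apply: eq_bigr => g _; rewrite !ffunE linearP scalerDr !scalerA.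
by rewrite mulrC.
Qed.
HB.instance Definition _ f :=
  GRing.isLinear.Build K IndV IndV *:%R (ind_act f) (ind_actP f).

Definition ind_map (f : A) : 'End(IndV) := linfun (ind_act f).

Lemma ind_mapE f w : ind_map f w = ind_act f w.
Proof. exact: lfunE. Qed.

Lemma ind_map_linear : linear ind_map.
Proof.
move=> x f1 f2; apply/lfunP=> w; rewrite add_lfunE scale_lfunE !ind_mapE.
apply/ffunP=> k; rewrite !ffunE scaler_sumr -big_split /=.
apply: eq_bigr => g _; rewrite cp_addE cp_scaleE linearP repDE repZE scalerDr.
by rewrite !scalerA mulrC.
Qed.
HB.instance Definition _ :=
  GRing.isLinear.Build K A 'End(IndV) *:%R ind_map ind_map_linear.

Lemma ind_act_single a g w k :
  ind_act (cp_single a g) w k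
  = c g (g^-1 * k)%g *: rho (act k^-1%g a) (w (g^-1 * k)%g).
Proof.
rewrite ffunE (bigD1 g) //= cp_singleE eqxx big1 ?addr0 // => h /negPf nhg.
by rewrite cp_singleE nhg !linear0 zero_lfunE scaler0.
Qed.

Lemma ind_map1 : ind_map 1 = \1%VF.
Proof.
apply/lfunP=> w; rewrite id_lfunE ind_mapE; apply/ffunP=> k.
rewrite crossed_1E ind_act_single invg1 mul1g cocycle1g // linearZ rmorph1.
by rewrite repZE rep1E scalerA mulfV // scale1r.
Qed.

Lemma ind_mapM f1 f2 : ind_map (f1 * f2) = (ind_map f1 \o ind_map f2)%VF.
Proof.
have singleM a1 a2 g1 g2 :
    ind_map ((cp_single a1 g1 : A) * (cp_single a2 g2 : A))
    = (ind_map (cp_single a1 g1) \o ind_map (cp_single a2 g2))%VF.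
  apply/lfunP=> w; rewrite comp_lfunE crossed_single_mul !ind_mapE.
  apply/ffunP=> k; rewrite !ind_act_single.
  rewrite linearZ rmorphM /= repZE repME [rho _ (_ *: _)]linearZ /= !scalerA.
  rewrite -(alg_actM actP) !invMg invgK !mulgA; congr (_ *: _).
  (* The scalars agree by the cocycle law at [g1], [g2], [g2^-1 * g1^-1 * k]. *)
  by rewrite mulrC (cocycleE cP) !mulgA mulgV mul1g mulrC.
rewrite (cp_expand f1) (cp_expand f2) mulr_suml linear_sum.
apply/lfunP=> w; rewrite comp_lfunE linear_sum !sum_lfunE.
apply: eq_bigr => g _; rewrite mulr_sumr !linear_sum /= !sum_lfunE linear_sum /=.
by apply: eq_bigr => h _; rewrite singleM comp_lfunE.
Qed.

Definition ind_rep : fd_rep A := FDRep ind_map1 ind_mapM.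

(** This is [\overline{1}] tensor [v]; as [\overline{1}] is a scalar multiple of the unit, the map
    is [Ae]-linear. *)
Definition ind_single (v : V) : IndV := [ffun k => if k == 1%g then v else 0].

Lemma ind_single_linear : linear ind_single.
Proof.
move=> x u v; apply/ffunP=> k; rewrite !ffunE; case: eqP => // _.
by rewrite scaler0 addr0.
Qed.
HB.instance Definition _ :=
  GRing.isLinear.Build K V IndV *:%R ind_single ind_single_linear.

Definition ind_coord (k : gT) (w : IndV) : V := w k.

Lemma ind_coord_linear k : linear (ind_coord k).
Proof. by move=> x u v; rewrite /ind_coord !ffunE. Qed.
HB.instance Definition _ k :=
  GRing.isLinear.Build K IndV V *:%R (ind_coord k) (ind_coord_linear k).

(** The coordinate at [k] is [V] twisted by [k^-1], so the one at 1 is [V] itself. *)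
Lemma ind_rep_embed a w k :
  (ind_rep (cp_embed a) w : IndV) k = rho (act k^-1%g a) (w k).
Proof.
rewrite /= ind_mapE ind_act_single invg1 mul1g cocycle1g // linearZ /= repZE.
by rewrite scalerA mulfV // scale1r.
Qed.

(** Isolates a single coefficient of [f], as the residual condition requires: only [g = k] brings
    the argument [g^-1 * k] to 1. *)
Lemma ind_rep_single f v k :
  (ind_rep f (ind_single v) : IndV) k = c k 1%g *: rho (act k^-1%g (f k)) v.
Proof.
rewrite /= ind_mapE ffunE (bigD1 k) //= mulVg ffunE eqxx big1 ?addr0 //.
move=> g /negPf ngk; rewrite ffunE -(inj_eq (mulgI g)) mulgA mulgV mul1g mulg1.
by rewrite eq_sym ngk linear0 scaler0.
Qed.

(* Ind V contains V as a direct summand over Ae, and Ind U cuts out U there. *)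
Lemma induced_completely_reducible :
  completely_reducible ind_rep -> completely_reducible rho.
Proof.
move=> /completely_reducibleP indP; apply/completely_reducibleP=> U sU.
have rhoU := proj1 (subrepP _) sU.
(* The functions with all values in [U], written as an intersection of preimages to obtain a
   subspace. *)
pose IndU := (\bigcap_k (linfun (ind_coord k) @^-1: U))%VS.
have IndUP (w : IndV) : w \in IndU <-> forall k, w k \in U.
  rewrite memvE; split=> [/subv_bigcapP wU k | wU].
    by have := wU k isT; rewrite -memvE -memv_preim lfunE.
  by apply/subv_bigcapP=> k _; rewrite -memvE -memv_preim lfunE; apply: wU.
have [|p [pC pU pid]] := indP IndU.
  apply/subrepP=> f w /IndUP wU; apply/IndUP=> k.
  rewrite /= ind_mapE ffunE memv_suml // => g _; rewrite memvZ //.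
  exact: rhoU (wU _).
pose q : 'End(V) := (linfun (ind_coord 1%g) \o p \o linfun ind_single)%VF.
have qE v : q v = (p (ind_single v) : IndV) 1%g.
  by rewrite !comp_lfunE !lfunE.
have rho_single a v :
    ind_single (rho a v) = ind_rep (cp_embed a) (ind_single v).
  apply/ffunP=> k; rewrite ind_rep_embed !ffunE; case: eqP => [->|_].
    by rewrite invg1 (alg_act1 actP).
  by rewrite linear0.
exists q; split=> [a v | v | u Uu]; rewrite qE.
- by rewrite rho_single pC ind_rep_embed invg1 (alg_act1 actP) qE.
- exact: (proj1 (IndUP _)).
- rewrite pid ?ffunE ?eqxx //; apply/IndUP=> k.
  by rewrite ffunE; case: eqP; rewrite ?mem0v.
Qed.

End Induction.

(** * Transfer of the FCR property *)

Lemma crossed_FCR_of_base :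
  #|gT|%:R != 0 :> K -> FCR_algebra Ae -> FCR_algebra A.
Proof.
move=> nzG [crAe annAe]; split=> [rho | f annf].
  exact: crossed_completely_reducible.
apply/ffunP=> k; rewrite ffunE; have actK : cancel (act k^-1%g) (act k).
  by move=> a; rewrite -(alg_actM actP) mulgV (alg_act1 actP).
(* The induced module only shows the twisted coefficient [act k^-1 (f k)], so the goal is first
   moved there. *)
apply: (can_inj actK); rewrite linear0; apply: annAe => rho.
apply/lfunP=> v; rewrite zero_lfunE.
have := ind_rep_single f v k; rewrite (annf (ind_rep rho)) zero_lfunE ffunE.
by move/esym/eqP; rewrite scaler_eq0 (negPf (c_neq0 _ _)) => /eqP.
Qed.

(** For the residual part, restriction along [cp_embed] shows that [cp_embed a] annihilates every
    representation of the crossed product; its coefficient at 1 is a nonzero multiple of [a]. *)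
Lemma base_FCR_of_crossed : FCR_algebra A -> FCR_algebra Ae.
Proof.
move=> [crA annA]; split=> [rho | a anna].
  exact: induced_completely_reducible.
have /(congr1 (fun f : A => f 1%g)) : cp_embed a = 0.
  by apply: annA => rho; apply: (anna (restrict_rep cp_embed rho)).
rewrite cp_singleE eqxx cp_0E => /eqP.
by rewrite scaler_eq0 invr_eq0 (negPf (c_neq0 _ _)) => /eqP.
Qed.

End CrossedProduct.

Theorem theorem4p2 (K : fieldType) (gT : finGroupType) (Ae : algType K)
    (act : gT -> {lrmorphism Ae -> Ae}) (c : gT -> gT -> K)
    (charK0 : [pchar K] =i pred0)
    (abelG : abelian [set: gT])
    (noethAe : noetherian Ae)
    (actP : alg_action act) (cP : cocycle c) :
  FCR_algebra (crossed_algebra actP cP) <-> FCR_algebra Ae.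
Proof.
split; first exact: base_FCR_of_crossed.
(* In characteristic zero the order of the group is nonzero in [K], which permits averaging. *)
apply: crossed_FCR_of_base; rewrite (proj1 (pcharf0P K) charK0) -lt0n.
by apply/card_gt0P; exists 1%g.
Qed.
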